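(* Let $c\ge 0$ be a constant. Let $N$ be a complete rotationally symmetric Riemannian manifold of dimension $n\ge 2$ with pole $o$ and metric $dr^2+\xi(r)^2d\vartheta^2$, whose radial sectional curvatures satisfy $$K(P_x)=-\frac{\xi''(r(x))}{\xi(r(x))}\le 0 .$$ Suppose, furthermore, that for some smooth positive function $h$, as $r\to\infty$, (i) $\displaystyle\left(\frac{\xi}{\xi'}\right)'=o\left(\min\left\{\max\left\{1,\left(\frac{\xi}{\xi'}\right)^2\right\},\ \max\left\{\frac{\xi}{\xi'},\frac{\xi'}{\xi}\right\}\right\}\right)$; (ii) $\displaystyle h\left(\frac{\xi}{\xi'}\right)'=o\left(\max\left\{\frac{\xi}{\xi'},\frac{\xi'}{\xi}\right\}\right)$; (iii) $\displaystyle\frac{h'}{h}=o\left(\max\left\{\frac{\xi'}{\xi},\frac{\xi}{\xi'}\right\}\right)$. Then the rotationally symmetric translating solitons $M_\varepsilon$, $\varepsilon\in[0,+\infty)$, in $N\times\mathbb{R}$ are described, outside a cylinder over a geodesic ball $B_R(o)\subset N$, as graphs or bi-graphs of functions $u=u(r)$ with the asymptotic behavior $$u'(r)=\frac{c}{n-1}\,\frac{\xi(r)}{\xi'(r)}+o\left(\frac1{h(r)}\right)\quad\text{as } r\to+\infty .$$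
   Context: Here $r(x)=d(o,x)$ is the distance to the pole, $d\vartheta^2$ is the metric of the unit sphere $\mathbb{S}^{n-1}\subset T_oN$, $\xi(0)=0$, $\xi'(0)=1$, primes denote derivatives in $r$, and $P_x$ is any $2$-plane in $T_xN$ containing $\nabla r(x)$. A translating soliton with velocity $c$ is a hypersurface $M\subset N\times\mathbb{R}$ with $cX^\perp=H$, where $H$ is the mean curvature vector field and $X=\partial_t$ is the standard coordinate vector field of $\mathbb{R}$. The graph of a radial function $u=u(r)$ is a translating soliton if and only if $$\frac{u''}{1+u'^2}+(n-1)\frac{\xi'(r)}{\xi(r)}u'-c=0 .$$ The solitons $M_\varepsilon$, $\varepsilon\in[0,+\infty)$, are the one-parameter family, constructed by de Lira and Martín, of rotationally symmetric translating solitons embedded in $N\times\mathbb{R}$: $M_0$ (the bowl soliton) is the graph of an entire radial solution, and each $M_\varepsilon$ with $\varepsilon>0$ (a winglike soliton) is a bi-graph over the exterior of the geodesic ball $B(o,\varepsilon)\subset N$, i.e. it is made up of the graphs of two radial functions there.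
   Formalization: For c = 0 only the bowl soliton M_0 is covered: the solitons M_ε with ε > 0 are treated only for c > 0, because for c = 0 they are minimal catenoids for which the stated asymptotics can fail for suitable ξ and h satisfying (i)–(iii). *)

(* Defs.v *)
From HB Require Import structures.
From mathcomp Require Import all_boot all_order all_algebra.
From mathcomp Require Import all_classical all_reals all_analysis.

Set Implicit Arguments.
Unset Strict Implicit.
Unset Printing Implicit Defensive.

Import Order.TTheory GRing.Theory Num.Theory.
Import numFieldNormedType.Exports.

Local Open Scope ring_scope.
Local Open Scope classical_set_scope.

Section Smoothness.
Variable R : realType.

(* C^oo on an open set D: all iterated directional derivatives are
   (Frechet) differentiable at every point of D. *)
Definition smooth_on (V : normedModType R) (D : set V) (f : V -> R) : Prop :=
  forall (s : seq V) (x : V), D x ->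
    differentiable (foldr (fun v g => 'D_v g) f s) x.

Definition smooth1_on (D : set R) (f : R -> R) : Prop :=
  forall (k : nat) (x : R), D x -> derivable (derive1n k f) x 1.

(* Unfolding of littleo at +oo, for which the library has no filter_on
   instance. *)
Definition little_o_infty (f g : R -> R) : Prop :=
  forall e : R, 0 < e -> \forall r \near +oo%R, `|f r| <= e * `|g r|.

End Smoothness.

(* Riemannian geometry of R^m with a metric given by its Gram matrix field G
   in the standard global coordinates; tangent vectors are row vectors. *)
Section Riemannian.
Variables (R : realType) (m : nat).
Notation V := 'rV[R]_m.
Variable G : V -> 'M[R]_m.

Definition partial (i : 'I_m) (f : V -> R) (p : V) : R :=
  'D_(delta_mx 0 i) f p.

Definition inner (p v w : V) : R := (v *m G p *m w^T) 0 0.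

Definition christoffel (p : V) (k i j : 'I_m) : R :=
  2^-1 * \sum_l invmx (G p) k l *
    (partial i (fun q => G q j l) p + partial j (fun q => G q i l) p
     - partial l (fun q => G q i j) p).

(* Levi-Civita derivative of the vector field Y in the direction v at p. *)
Definition nabla (v : V) (Y : V -> V) (p : V) : V :=
  \row_k \sum_i v 0 i *
    (partial i (fun q => Y q 0 k) p + \sum_j christoffel p k i j * Y p 0 j).

Definition gradient (f : V -> R) (p : V) : V :=
  \row_k \sum_l invmx (G p) k l * partial l f p.

Definition unit_normal (f : V -> R) (p : V) : V :=
  (Num.sqrt (inner p (gradient f p) (gradient f p)))^-1 *: gradient f p.

(* Mean curvature vector at p of the level set of f through p, normalized as
   the (non-averaged) trace of the second fundamental form:
   H = tr(v |-> - nabla_v nu) nu.  The trace may be taken over the whole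
   tangent space of the ambient manifold, because <nabla_nu nu, nu> = 0 for the
   unit field nu. *)
Definition mean_curvature_vector (f : V -> R) (p : V) : V :=
  - (\sum_k nabla (delta_mx 0 k) (unit_normal f) p 0 k) *: unit_normal f p.

Definition normal_part (f : V -> R) (p v : V) : V :=
  inner p v (unit_normal f p) *: unit_normal f p.

Definition local_defining_function (M U : set V) (f : V -> R) : Prop :=
  [/\ open U, smooth_on U f,
      forall q, U q -> exists i, partial i f q != 0
    & M `&` U = [set q | U q /\ f q = 0]].

Definition embedded_hypersurface (M : set V) : Prop :=
  forall p, M p -> exists U f, U p /\ local_defining_function M U f.

(* c X^perp = H along M.  H and the normal projection do not depend on the
   local defining function used to compute them. *)
Definition translating_soliton (X : V -> V) (c : R) (M : set V) : Prop :=
  embedded_hypersurface M /\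
  forall (U : set V) (f : V -> R) (p : V),
    local_defining_function M U f -> U p -> M p ->
    c *: normal_part f p (X p) = mean_curvature_vector f p.

End Riemannian.

(* N is R^n (polar normal coordinates at the pole o = 0), and N x R is
   R^(n + 1), the last coordinate being t. *)
Section RotationalManifold.
Variables (R : realType) (n : nat).

(* Distance to the pole.  The norm `|x| of the library is the sup norm. *)
Definition pole_dist (x : 'rV[R]_n) : R := Num.sqrt (\sum_i x 0 i ^+ 2).

(* Smoothness of dr^2 + xi(r)^2 dtheta^2 across the pole amounts to xi being the
   restriction to [0, +oo[ of a smooth odd function; xi denotes that
   function.  That r ranges over the whole of [0, +oo[ is completeness. *)
Record rotational_profile (xi : R -> R) : Prop := RotationalProfile {
  profile_smooth : smooth1_on setT xi;
  profile_odd : forall r, xi (- r) = - xi r;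
  profile0 : xi 0 = 0;
  profile_deriv0 : derive1 xi 0 = 1;
  profile_gt0 : forall r, 0 < r -> 0 < xi r
}.

Definition radial_curvature (xi : R -> R) (r : R) : R :=
  - (derive1n 2 xi r / xi r).

(* dr^2 + xi(r)^2 dtheta^2 in Cartesian coordinates: with P the Euclidean
   orthogonal projection onto the radial line, P + (xi(r)/r)^2 (1 - P); at the
   pole, where P = 0 in the formula below, this is the identity. *)
Definition rot_metric (xi : R -> R) (x : 'rV[R]_n) : 'M[R]_n :=
  let r := pole_dist x in
  let P := (r ^+ 2)^-1 *: (x^T *m x) in
  let a := if r == 0 then 1 else (xi r / r) ^+ 2 in
  P + a *: (1%:M - P).

Definition base (p : 'rV[R]_(n + 1)) : 'rV[R]_n := lsubmx p.
Definition height (p : 'rV[R]_(n + 1)) : R := rsubmx p 0 0.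
Definition radius (p : 'rV[R]_(n + 1)) : R := pole_dist (base p).

Definition product_metric (xi : R -> R) (p : 'rV[R]_(n + 1)) :
  'M[R]_(n + 1) := block_mx (rot_metric xi (base p)) 0 0 1%:M.

Definition dt : 'rV[R]_(n + 1) -> 'rV[R]_(n + 1) := fun=> row_mx 0 1%:M.

Definition soliton (xi : R -> R) (c : R) (M : set 'rV[R]_(n + 1)) : Prop :=
  translating_soliton (product_metric xi) dt c M.

Definition bowl_soliton (xi : R -> R) (c : R) (M : set 'rV[R]_(n + 1)) : Prop :=
  soliton xi c M /\
  exists u : R -> R,
    smooth_on setT (fun x : 'rV[R]_n => u (pole_dist x)) /\
    M = [set p | height p = u (radius p)].

(* The two graphs are glued along the sphere r = eps, where M, a smooth
   hypersurface without boundary, has a vertical tangent space. *)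
Definition winglike_soliton (xi : R -> R) (c eps : R)
    (M : set 'rV[R]_(n + 1)) : Prop :=
  soliton xi c M /\
  exists u1 u2 : R -> R,
    [/\ smooth_on [set x : 'rV[R]_n | eps < pole_dist x]
          (fun x => u1 (pole_dist x)),
        smooth_on [set x : 'rV[R]_n | eps < pole_dist x]
          (fun x => u2 (pole_dist x)),
        u1 eps = u2 eps,
        forall r, eps < r -> u1 r < u2 r
      & M = [set p | eps <= radius p /\
               (height p = u1 (radius p) \/ height p = u2 (radius p))]].

(* M is the soliton M_eps, up to a vertical translation. *)
Definition soliton_family (xi : R -> R) (c eps : R)
    (M : set 'rV[R]_(n + 1)) : Prop :=
  if eps == 0 then bowl_soliton xi c M else winglike_soliton xi c eps M.

Definition soliton_asymptotics (xi h : R -> R) (c : R) (u : R -> R) : Prop :=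
  (\forall r \near +oo%R, derivable u r 1) /\
  little_o_infty
    (fun r => derive1 u r - c / (n.-1)%:R * (xi r / derive1 xi r))
    (fun r => (h r)^-1).

Definition outside_cylinder (rho : R) (M : set 'rV[R]_(n + 1)) :
  set 'rV[R]_(n + 1) := [set p | M p /\ rho < radius p].

Definition is_graph_outside (rho : R) (M : set 'rV[R]_(n + 1)) (u : R -> R) :
  Prop :=
  outside_cylinder rho M = [set p | rho < radius p /\ height p = u (radius p)].

Definition is_bigraph_outside (rho : R) (M : set 'rV[R]_(n + 1))
    (u1 u2 : R -> R) : Prop :=
  (forall r, rho < r -> u1 r < u2 r) /\
  outside_cylinder rho M =
    [set p | rho < radius p /\
       (height p = u1 (radius p) \/ height p = u2 (radius p))].

End RotationalManifold.

(* Main.v *)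
(* A vertical graph [t = u(r)] is the zero set of [t - u(r)], whose unit normal
   is [nu = (- u' d_r + d_t) / W] with [W = sqrt (1 + u'^2)].  By symmetry it
   suffices to compute [div nu] at points of one axis, where it equals
   [- ((u' / W)' + (n - 1) (xi' / xi) (u' / W))], so the soliton equation becomes
   [u'' = (1 + u'^2) (c - (n - 1) u' / q)] with [q = xi / xi'].  Every solution of
   this equation on a ray has the claimed asymptotics.  Put [k = n - 1].
   - If [c = 0], then [xi^(2 k) (1 - 1 / W^2)] is constant and tends to [0] at the
     pole, hence [u' = 0].
   - If [c > 0], nonpositive curvature gives [q' <= 1], so [u' - c / (4 k) q] grows
     at a definite rate wherever it is negative, and [u' >= c / (4 k) q] eventually.
     Then [(1 + u'^2) / q] dominates [max (q, 1 / q)], and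
     [w = h (u' - c / k q)] satisfies [w' = - A w + B] with
     [A >= const * max (q, 1 / q)] by (iii) and [B = o(max (q, 1 / q))] by (ii);
     since [max (q, 1 / q) >= 1], [w] tends to [0]. *)
Require Import Defs.
From HB Require Import structures.
From mathcomp Require Import all_boot all_order all_algebra.
From mathcomp Require Import all_classical all_reals all_analysis.
From mathcomp Require Import ring lra.
Set Implicit Arguments.
Unset Strict Implicit.
Unset Printing Implicit Defensive.
Import Order.TTheory GRing.Theory Num.Theory.
Import numFieldNormedType.Exports.
Local Open Scope ring_scope.
Local Open Scope classical_set_scope.

(** * Solutions of the radial equation *)

Lemma is_derive1_within (R : realType) (g dg : R -> R) (a x y : R) :
  (forall r, a < r -> is_derive r 1 g (dg r)) -> a < x ->
  {within `[x, y], continuous g}.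
Proof.
move=> g_dg ax; apply: derivable_within_continuous => z.
by rewrite in_itv /= => /andP[xz _]; have [] := g_dg z (lt_le_trans ax xz).
Qed.

Lemma MVT_ray (R : realType) (g dg : R -> R) (a x y : R) :
  (forall r, a < r -> is_derive r 1 g (dg r)) -> a < x -> x < y ->
  exists z, [/\ x < z, z < y & g y - g x = dg z * (y - x)].
Proof.
move=> g_dg ax xy.
have [z zxy|z zxy ->] := @MVT R g dg x y xy _ (is_derive1_within g_dg ax).
  by apply: g_dg; move: zxy; rewrite in_itv /= => /andP[+ _]; apply: lt_trans.
by exists z; move: zxy; rewrite in_itv /= => /andP[].
Qed.

(** Above the level [K] the function falls at speed at least [d], so it reaches that level in finite
    time. It cannot rise through it afterwards: a maximum above [K] would be preceded by values that
    are still falling. *)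
Lemma eventually_le_of_derive (R : realType) (g dg : R -> R) (a K d : R) :
  0 < d -> (forall r, a < r -> is_derive r 1 g (dg r)) ->
  (forall r, a < r -> K < g r -> dg r <= - d) ->
  \forall r \near +oo%R, g r <= K.
Proof.
move=> d0 g_dg dg_le.
have [r0 ar0 gr0] : exists2 r0, a < r0 & g r0 <= K.
  apply: contrapT => noentry.
  have gtK r : a < r -> K < g r.
    by move=> ar; rewrite ltNge; apply/negP => grK; apply: noentry; exists r.
  have a1 : a < a + 1 by rewrite ltrDl.
  (* A descent at speed [d] from the value [g (a + 1)] reaches [K] after time [T]. *)
  pose T := (g (a + 1) - K) / d.
  have T0 : 0 < T by rewrite divr_gt0 // subr_gt0 gtK.
  have [|z [az _ gz]] := MVT_ray g_dg a1 (y := a + 1 + T); first by rewrite ltrDl.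
  have az' : a < z by apply: lt_trans az.
  have : dg z * (a + 1 + T - (a + 1)) <= - d * T.
    by rewrite addrAC subrr add0r ler_pM2r // dg_le // gtK.
  rewrite -gz mulNr mulrC divfK ?gt_eqF // opprB lerBlDr subrK.
  by apply/negP; rewrite -ltNge gtK // (lt_trans a1) // ltrDl.
near=> r.
have r0r : r0 <= r by near: r; apply: nbhs_pinfty_ge; rewrite num_real.
rewrite leNgt; apply/negP => Kgr.
have r0r' : r0 < r by rewrite lt_neqAle r0r andbT; apply: contraTneq Kgr => <-; rewrite -leNgt.
(* If [g r] exceeded [K], the maximum over [[r0, r]] would too, so it would be attained strictly to
   the right of [r0]. *)
have [t] := EVT_max r0r (is_derive1_within g_dg ar0).
rewrite in_itv /= => /andP[r0t tr] tmax.
have Kgt : K < g t by apply: lt_le_trans Kgr _; apply: tmax; rewrite in_itv /= r0r lexx.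
have {}r0t : r0 < t by rewrite lt_neqAle r0t andbT; apply: contraTneq Kgt => <-; rewrite -leNgt.
have at_ : a < t := lt_trans ar0 r0t.
have /cvgrPdist_lt/(_ (g t - K)) : {for t, continuous g}.
  by apply: differentiable_continuous; apply/derivable1_diffP; have [] := g_dg t at_.
rewrite subr_gt0 => /(_ Kgt) [e /= e0 he].
(* The distance from [s] to [t] is below [e], so [g] stays above [K] between them and must decrease
   strictly from [s] to [t], against the maximality at [t]. *)
pose s := Num.max r0 (t - e / 2).
have r0s : r0 <= s by rewrite le_max lexx.
have st : s < t by rewrite gt_max r0t ltrBlDr ltrDl divr_gt0.
have [z [sz zt gz]] := MVT_ray g_dg (lt_le_trans ar0 r0s) st.
have : g s <= g t by apply: tmax; rewrite in_itv /= r0s (le_trans (ltW st)).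
rewrite -subr_ge0 gz pmulr_lge0 ?subr_gt0 //.
apply/negP; rewrite -ltNge (@le_lt_trans _ _ (- d)) ?oppr_lt0 // dg_le //.
  by rewrite (lt_trans ar0) // (le_lt_trans r0s).
have := he z; rewrite /= distrC ltr0_norm ?subr_lt0 // => /(_ _).
have -> : - (z - t) < e.
  have : t - e / 2 <= s by rewrite le_max lexx orbT.
  lra.
move=> /(_ isT); rewrite ltr_norml => /andP[]; lra.
Unshelve. all: by end_near.
Qed.
Lemma max_inv_ge1 (R : realFieldType) (x : R) : 0 < x -> 1 <= Num.max x x^-1.
Proof.
move=> x0; rewrite le_max; have [//|x1 /=] := leP 1 x.
by rewrite invf_ge1 // ltW.
Qed.

Lemma near_pinfty_ex (R : realType) (a : R) (P : R -> Prop) :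
  (\forall r \near +oo%R, P r) -> exists2 b, a < b & forall r, b < r -> P r.
Proof.
move=> [b [_ bP]]; exists (Num.max b (a + 1)).
  by rewrite lt_max ltrDl ltr01 orbT.
by move=> r; rewrite gt_max => /andP[/bP].
Qed.

(** Here [phi] is the slope [u'], [k] is [n - 1] and [q] is [xi / xi']. Both estimates come from
    [eventually_le_of_derive], applied to [y * q - phi] and then to [w ^+ 2]. *)
Lemma soliton_ode_asymptotics (R : realType) (c k a : R)
    (phi q dq h dh : R -> R) :
  0 < c -> 1 <= k ->
  (forall r, a < r -> 0 < q r) ->
  (forall r, a < r -> is_derive r 1 q (dq r)) ->
  (forall r, a < r -> dq r <= 1) ->
  (forall r, a < r ->
     is_derive r 1 phi ((1 + phi r ^+ 2) * (c - k * phi r / q r))) ->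
  (forall r, a < r -> 0 < h r) ->
  (forall r, a < r -> is_derive r 1 h (dh r)) ->
  little_o_infty (fun r => h r * dq r) (fun r => Num.max (q r) (q r)^-1) ->
  little_o_infty (fun r => dh r / h r) (fun r => Num.max (q r) (q r)^-1) ->
  little_o_infty (fun r => phi r - c / k * q r) (fun r => (h r)^-1).
Proof.
move=> c0 k1 q0 q_dq dq1 phi_ode h0 h_dh o_hdq o_dh.
have k0 : 0 < k by apply: lt_le_trans k1.
(* Where [phi < y * q], this choice gives [k * phi / q <= c / 4], hence [phi' >= 3 c / 4], while
   [y * q' <= y <= c / 4] because [1 <= k]. So [y * q - phi] falls at speed at least [c / 2]. *)
pose y := c / (4 * k).
have y0 : 0 < y by rewrite divr_gt0 // mulr_gt0.
have ky : k * y = c / 4 by rewrite /y; field; lra.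
have yc : y <= c / 4.
  by rewrite -ky ler_peMl // ltW.
have lower : \forall r \near +oo%R, y * q r - phi r <= 0.
  pose dg r := y * dq r - (1 + phi r ^+ 2) * (c - k * phi r / q r).
  apply: (@eventually_le_of_derive _ _ dg a 0 (c / 2)); first by rewrite divr_gt0.
    move=> r ar; have ? := q_dq r ar; have ? := phi_ode r ar.
    by apply: (@is_derive_eq _ _ _ (y \*: q - phi)).
  move=> r ar phi_lt; rewrite /dg.
  have qr0 := q0 r ar.
  have phiq : k * phi r / q r <= c / 4.
    by rewrite -ky ler_pdivrMr // -mulrA ler_pM2l //; lra.
  have ydq : y * dq r <= c / 4.
    by apply: le_trans yc; rewrite ger_pMr // dq1.
  have : 1 * (c - k * phi r / q r) <= (1 + phi r ^+ 2) * (c - k * phi r / q r).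
    by rewrite ler_pM2r; [rewrite lerDl sqr_ge0|lra].
  lra.
(* Once [y * q <= phi], the quotient [(1 + phi ^+ 2) / q] is at least [1 / q] and at least
   [y ^+ 2 * q], hence at least [delta * max (q, 1 / q)]. *)
pose delta := Num.min 1 (y ^+ 2).
have delta0 : 0 < delta by rewrite lt_min ltr01 exprn_gt0.
pose S r := Num.max (q r) (q r)^-1.
have S_ge1 r : a < r -> 1 <= S r by move=> ar; apply/max_inv_ge1/q0.
move=> e e0; have e0' := ltW e0.
(* Chosen so that [c / k * e1 = e * (k * delta / 4)], the bound that [B_le] needs. *)
pose e1 := e * delta * k / (4 * c) * k.
have e10 : 0 < e1 by rewrite !(mulr_gt0, divr_gt0, invr_gt0).
have e20 : 0 < k * delta / 2 by rewrite !(mulr_gt0, divr_gt0).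
have [b ab tail] := near_pinfty_ex a
  (filterI lower (filterI (o_hdq e1 e10) (o_dh _ e20))).
have lowerb r : b < r -> y * q r <= phi r.
  by move=> /tail[? _]; rewrite -subr_le0.
have hdqb r : b < r -> `|h r * dq r| <= e1 * S r.
  move=> br; have [_ []] := tail r br.
  by rewrite (ger0_norm (_ : 0 <= S r)) // (le_trans ler01) // S_ge1 // (lt_trans ab).
have dhb r : b < r -> `|dh r / h r| <= k * delta / 2 * S r.
  move=> br; have [_ []] := tail r br.
  by rewrite (ger0_norm (_ : 0 <= S r)) // (le_trans ler01) // S_ge1 // (lt_trans ab).
pose w r := h r * (phi r - c / k * q r).
pose A r := k * (1 + phi r ^+ 2) / q r - dh r / h r.
pose B r := - (c / k * (h r * dq r)).
(* The equation is linear in [w] because [c - k * phi / q = - (k / q) * (phi - c / k * q)]. *)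
have w_dw r : b < r -> is_derive r 1 w (- A r * w r + B r).
  move=> br; have ar := lt_trans ab br.
  have ? := q_dq r ar; have ? := phi_ode r ar; have ? := h_dh r ar.
  apply: (@is_derive_eq _ _ _ (h * (phi - c / k \*: q))).
  have := q0 r ar; have := h0 r ar; rewrite /A /B /w /GRing.scale /= => hr qr.
  by rewrite !fctE (_ : ((c / k) \*: q) r = c / k * q r) //; field; rewrite !gt_eqF.
(* The main term of [A] is at least [k * delta * S], and [h' / h] takes away at most half of
   that. *)
have A_ge r : b < r -> k * delta / 2 * S r <= A r.
  move=> br; have ar := lt_trans ab br; have qr := q0 r ar.
  rewrite /A; have := dhb r br; rewrite ler_norml => /andP[_ dhle].
  suff : delta * S r <= (1 + phi r ^+ 2) / q r.
    rewrite -(ler_pM2l k0) !mulrA; lra.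
  rewrite ler_pdivlMr //.
  have yq : (y * q r) ^+ 2 <= phi r ^+ 2.
    have yq0 : 0 <= y * q r by apply: ltW; apply: mulr_gt0.
    by rewrite ler_sqr ?nnegrE ?lowerb // (le_trans yq0) ?lowerb.
  have d1 : delta <= 1 by rewrite ge_min lexx.
  have dy : delta <= y ^+ 2 by rewrite ge_min lexx orbT.
  rewrite /S; case: (leP (q r) (q r)^-1) => _.
    by rewrite mulfVK ?gt_eqF // (le_trans d1) // lerDl sqr_ge0.
  rewrite -mulrA -expr2 (le_trans _ (_ : phi r ^+ 2 <= _)) ?lerDr //.
  by apply: le_trans yq; rewrite exprMn ler_pM2r ?exprn_gt0.
have B_le r : b < r -> `|B r| <= e * (k * delta / 4) * S r.
  move=> br; rewrite /B normrN normrM gtr0_norm ?divr_gt0 //.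
  apply: le_trans (ler_wpM2l (ltW _) (hdqb r br)) _; first exact: divr_gt0.
  rewrite [leLHS]mulrA ler_pM2r; last by rewrite (lt_le_trans ltr01) // S_ge1 // (lt_trans ab).
  by rewrite le_eqVlt; apply/orP; left; apply/eqP; rewrite /e1; field; rewrite !gt_eqF.
(* Where [e < |w|], the term [2 w B] is at most half of [k * delta * S * w ^+ 2], so [w ^+ 2] falls
   at speed at least [(k * delta / 2) * S * w ^+ 2], and this exceeds [d] since [1 <= S]. *)
pose d := e ^+ 2 * (k * delta / 2).
have w_le : \forall r \near +oo%R, w r ^+ 2 <= e ^+ 2.
  apply: (@eventually_le_of_derive _ _ (fun r => 2 * w r * (- A r * w r + B r)) b _ d).
  - by rewrite mulr_gt0 ?exprn_gt0 // !(mulr_gt0, divr_gt0).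
  - move=> r br; have ? := w_dw r br.
    by apply: (@is_derive_eq _ _ _ (w ^+ 2)); rewrite /= expr1.
  - move=> r br wr.
    have ew : e <= `|w r|.
      by rewrite -ler_sqr ?nnegrE ?normr_ge0 // real_normK ?num_real // ltW.
    have S1 : 1 <= S r by rewrite S_ge1 // (lt_trans ab).
    have wB : w r * B r <= `|w r| * (`|w r| * (k * delta / 4) * S r).
      apply: le_trans (ler_norm _) _; rewrite normrM ler_wpM2l //.
      apply: le_trans (B_le r br) _; rewrite ler_pM2r ?(lt_le_trans ltr01) //.
      by rewrite ler_pM2r // !(mulr_gt0, divr_gt0).
    have wA : w r ^+ 2 * (k * delta / 2 * S r) <= w r ^+ 2 * A r.
      by rewrite ler_wpM2l ?sqr_ge0 ?A_ge.
    have wd : d * 1 <= w r ^+ 2 * (k * delta / 2) * S r.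
      apply: ler_pM; rewrite ?ler01 // ?ler_wpM2r ?ltW // /d !(mulr_gt0, divr_gt0, exprn_gt0) //.
    have n2 : `|w r| * `|w r| = w r ^+ 2 by rewrite -expr2 real_normK ?num_real.
    rewrite !mulrA n2 in wB; lra.
near=> r.
have br : b < r by near: r; apply: nbhs_pinfty_gt; rewrite num_real.
have hr : 0 < h r by apply: h0; apply: lt_trans br.
rewrite (gtr0_norm (_ : 0 < (h r)^-1)) ?invr_gt0 // ler_pdivlMr //.
rewrite -{1}(gtr0_norm hr) -normrM mulrC.
rewrite -ler_sqr ?nnegrE ?normr_ge0 // real_normK ?num_real //.
by near: r.
Unshelve. all: by end_near.
Qed.
(** The first integral [E] is the square of the flux [xi^k * phi / sqrt (1 + phi^2)] through a
    geodesic sphere. Its second factor lies between [0] and [1] and [xi] vanishes at the pole, so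
    the constant value of [E] is [0]. *)
Lemma radial_minimal_const (R : realType) (k : nat) (phi xi dxi : R -> R) :
  (0 < k)%N ->
  (forall r : R, 0 < r -> 0 < xi r) ->
  (forall r : R, 0 < r -> is_derive r 1 xi (dxi r)) ->
  {for 0, continuous xi} -> xi 0 = 0 ->
  (forall r : R, 0 < r ->
    is_derive r 1 phi (- ((1 + phi r ^+ 2) * (k%:R * phi r * (dxi r / xi r))))) ->
  forall r : R, 0 < r -> phi r = 0.
Proof.
move=> k0 xi0 xi_dxi xi_cont xi00 phi_ode r r0.
pose E r := xi r ^+ k.*2 * (1 - (1 + phi r ^+ 2)^-1).
have den_gt0 x : 0 < 1 + phi x ^+ 2 by rewrite ltr_pwDl ?sqr_ge0.
have E_cst (x : R) : 0 < x -> is_derive x 1 E 0.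
  move=> x0; have H := phi_ode x x0; have ? := xi_dxi x x0; have xix := xi0 x x0.
  have ? : is_derive x 1 (fun r => (1 + phi r ^+ 2)^-1)
      (- (1 + phi x ^+ 2) ^- 2 *:
        (2 * phi x * - ((1 + phi x ^+ 2) * (k%:R * phi x * (dxi x / xi x))))).
    apply: is_deriveV; first by rewrite gt_eqF.
    apply: (is_derive_eq (is_deriveD (is_derive_cst (1 : R) x 1) (is_deriveX 2 H))).
    by rewrite add0r expr1.
  have -> : E = xi ^+ k.*2 * (cst 1 - (fun r => (1 + phi r ^+ 2)^-1)).
    by apply/funext => z; rewrite /E !fctE.
  apply: is_derive_eq.
  rewrite /GRing.scale /= !fctE /cst.
  have k2 : k.*2%:R = 2 * k%:R :> R by rewrite -mul2n natrM.
  (* Differentiating the power lowers its exponent; writing [k.*2] as a successor lets [field] match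
     the two powers. *)
  rewrite -(@prednK k.*2) ?double_gt0 // in k2 *.
  rewrite exprS /= k2.
  by field; rewrite !gt_eqF.
have E_eq s : 0 < s -> s < r -> E s = E r.
  move=> s0 sr; have [z [_ _ /eqP]] := MVT_ray E_cst s0 sr.
  by rewrite mul0r subr_eq0 => /eqP.
have E_le e : 0 < e -> E r <= e.
  move=> e0.
  have /cvgrPdist_lt/(_ (Num.min 1 e)) := xi_cont.
  rewrite lt_min ltr01 e0 => /(_ isT) [d /= d0 xi_small].
  (* At this [s] one has [xi s < 1] and [xi s < e], so [xi s ^+ k.*2 <= xi s < e]; the first
     inequality uses [0 < k]. *)
  pose s := Num.min (d / 2) (r / 2).
  have s0 : 0 < s by rewrite lt_min !divr_gt0.
  have sd : s < d by rewrite gt_min; apply/orP; left; lra.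
  have sr : s < r by rewrite gt_min; apply/orP; right; lra.
  have := xi_small s; rewrite /= sub0r normrN gtr0_norm // xi00 sub0r normrN.
  rewrite gtr0_norm ?xi0 // lt_min => /(_ sd) /andP[xis1 xise].
  have xis : 0 <= xi s by rewrite ltW ?xi0.
  rewrite -(E_eq s) // /E (le_trans _ (ltW xise)) //.
  have inv_ge0 : 0 <= (1 + phi s ^+ 2)^-1 by rewrite invr_ge0 ltW.
  rewrite (@le_trans _ _ (xi s ^+ k.*2 * 1)) //.
    by rewrite ler_wpM2l ?exprn_ge0 // gerBl.
  rewrite mulr1; case: k k0 {phi_ode E E_cst E_eq} => // k _.
  by rewrite doubleS exprS ler_piMr // exprn_ile1 // ltW.
have E_le0 : E r <= 0 by apply/ler_addgt0Pl => e e0; rewrite addr0 E_le.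
apply/eqP; rewrite -sqrf_eq0 eq_le sqr_ge0 andbT.
move: E_le0; rewrite /E pmulr_rle0 ?exprn_gt0 ?xi0 // subr_le0 invf_ge1 //.
by rewrite gerDl.
Qed.
(** * Smooth functions on open sets *)

(** The differential of [f] also serves for [g], since both functions have the same first-order
    expansion at [x]. *)
Lemma near_eq_differentiable (R : numFieldType) (V W : normedModType R)
    (f g : V -> W) (x : V) :
  (\near x, f x = g x) -> differentiable f x -> differentiable g x.
Proof.
move=> fg df.
have expansion : g \o shift x = cst (g x) + 'd f x +o_ (0 : V) id.
  have /eqaddoP df_o := diff_locally df.
  apply/eqaddoP => e e0; have := df_o e e0.
  have fg0 : \forall y \near (0 : V), f (y + x) = g (y + x).
    by move: fg; rewrite (near_shift 0 x); apply: filterS => y /=; rewrite subr0.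
  apply: filterS2 fg0 => y /= fgy.
  by rewrite !fctE /cst /= fgy (nbhs_singleton fg).
have dE := diff_unique (diff_continuous df) expansion.
by apply/diff_locallyP; rewrite dE; split=> //; exact: diff_continuous.
Qed.

Lemma eq_on_open_near (R : numFieldType) (V W : normedModType R) (D : set V)
    (f g : V -> W) (x : V) :
  open D -> {in D, f =1 g} -> D x -> \near x, f x = g x.
Proof.
move=> openD fg Dx; near=> y; apply: fg; rewrite inE; near: y.
exact: open_nbhs_nbhs.
Unshelve. all: by end_near.
Qed.

(** Iterated derivatives of the difference split only on [D]. Openness of [D] makes that enough to
    differentiate once more. *)
Lemma smooth_onB (R : realType) (V : normedModType R) (D : set V)
    (f g : V -> R) :
  open D -> smooth_on D f -> smooth_on D g -> smooth_on D (f - g).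
Proof.
move=> openD f_smooth g_smooth s.
pose Dseq (k : V -> R) := foldr (fun v k => 'D_v k) k.
have E : {in D, Dseq (f - g) s =1 Dseq f s - Dseq g s}.
  elim: s => // v s IH x /[!inE] Dx.
  rewrite [LHS](near_eq_derive v (eq_on_open_near openD IH Dx)).
  by rewrite deriveB //; apply: diff_derivable; [apply: f_smooth|apply: g_smooth].
move=> x Dx; apply: (@near_eq_differentiable _ _ _ (Dseq f s - Dseq g s)).
  by apply: filterS (eq_on_open_near openD E Dx) => y /esym.
by apply: differentiableB; [apply: f_smooth|apply: g_smooth].
Qed.

(** By the chain rule, differentiating [g \o L] along [v] amounts to differentiating [g] along
    [L v], so the list of directions is simply mapped through [L]. *)
Lemma smooth_on_comp_linear (R : realType) (V W : normedModType R)
    (L : {linear V -> W}) (D : set W) (g : W -> R) :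
  continuous L -> open D -> smooth_on D g -> smooth_on (L @^-1` D) (g \o L).
Proof.
move=> L_cont openD g_smooth s.
pose Dseq (X : normedModType R) (k : X -> R) := foldr (fun v k => 'D_v k) k.
have openLD : open (L @^-1` D) by apply: open_comp => // x _; exact: L_cont.
have E : {in L @^-1` D, Dseq _ (g \o L) s =1 Dseq _ g (map L s) \o L}.
  elim: s => // v s IH x /[!inE] Dx.
  rewrite [LHS](near_eq_derive v (eq_on_open_near openLD IH Dx)) /=.
  have dL : differentiable L x by apply: linear_differentiable.
  have dg : differentiable (Dseq _ g (map L s)) (L x) by apply: g_smooth.
  rewrite deriveE; last exact: differentiable_comp.
  by rewrite diff_comp //= diff_lin // deriveE.
move=> x Dx; apply: (@near_eq_differentiable _ _ _ (Dseq _ g (map L s) \o L)).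
  by apply: filterS (eq_on_open_near openLD E Dx) => y /esym.
apply: differentiable_comp; first exact: linear_differentiable.
exact: g_smooth.
Qed.

Lemma smooth_on_sub (R : realType) (V : normedModType R) (D E : set V)
    (f : V -> R) : D `<=` E -> smooth_on E f -> smooth_on D f.
Proof. by move=> DE fE s x /DE; apply: fE. Qed.
(** * Distance to the pole *)

(** The two difference quotients are the same function. This reduces directional derivatives to
    calculus in one variable. *)
Lemma is_derive_line (R : numFieldType) (V W : normedModType R) (f : V -> W)
    (x v : V) (s : R) (l : W) :
  is_derive (x + s *: v) v f l <-> is_derive s 1 (fun t => f (x + t *: v)) l.
Proof.
pose g t := f (x + t *: v).
have E : (fun h : R => h^-1 *: ((f \o shift (x + s *: v)) (h *: v) - f (x + s *: v))) =
    (fun h => h^-1 *: ((g \o shift s) (h *: (1 : R)) - g s)).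
  apply/funext => h; rewrite /g /=; congr (_ *: (f _ - _)).
  by rewrite [h *: 1]mulr1 scalerDl addrCA.
split=> -[dl dE]; apply: DeriveDef; move: dl dE; rewrite /derivable /derive.
- by rewrite E.
- by rewrite E.
- by rewrite -/g -E.
- by rewrite -/g -E.
Qed.

Lemma is_derive_line0 (R : numFieldType) (V W : normedModType R) (f : V -> W)
    (x v : V) (l : W) :
  is_derive x v f l <-> is_derive (0 : R) 1 (fun t => f (x + t *: v)) l.
Proof. by rewrite -is_derive_line scale0r addr0. Qed.

(** Restriction to the line through [x] along [v] makes the one-variable chain rule suffice, with
    [f] differentiable in that direction only. *)
Lemma is_derive_outer_comp (R : realType) (V : normedModType R) (f : V -> R)
    (g : R -> R) (x v : V) (df dg : R) :
  is_derive x v f df -> is_derive (f x) 1 g dg ->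
  is_derive x v (g \o f) (dg * df).
Proof.
move=> /is_derive_line0 f_df g_dg; apply/is_derive_line0.
by apply: (@is_derive1_comp _ g); rewrite ?scale0r ?addr0.
Qed.

Lemma pole_dist_axis (R : realType) (n : nat) (i0 : 'I_n) (r : R) :
  pole_dist (r *: delta_mx 0 i0) = `|r|.
Proof.
rewrite /pole_dist (bigD1 i0) //= big1 ?addr0.
  by rewrite !mxE !eqxx mulr1 sqrtr_sqr.
by move=> i ii0; rewrite !mxE (negbTE ii0) andbF mulr0 expr0n.
Qed.

Lemma pole_dist_continuous (R : realType) (n : nat) :
  continuous (@pole_dist R n).
Proof.
move=> x; apply: continuous_comp; last exact: sqrt_continuous.
apply: differentiable_continuous.
rewrite (_ : (fun y : 'rV[R]_n => _) = \sum_i (fun y : 'rV[R]_n => y 0 i) ^+ 2).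
  by apply: differentiable_sum => i; apply: differentiableX; exact: differentiable_coord.
by apply/funext => y; rewrite fct_sumE.
Qed.

Lemma open_pole_dist_gt (R : realType) (n : nat) (eps : R) :
  open [set x : 'rV[R]_n | eps < pole_dist x].
Proof.
rewrite [X in open X](_ : _ = @pole_dist R n @^-1` [set y | eps < y]) //.
by apply: open_comp => [x _|]; [exact: pole_dist_continuous|exact: open_gt].
Qed.

Lemma near_gt (R : realType) (a r : R) : a < r -> \forall s \near r, a < s.
Proof. by move=> ar; apply: open_nbhs_nbhs; split => //; exact: open_gt. Qed.

(** On the positive half of a coordinate axis the distance to the pole is the coordinate itself, so
    derivatives of the radial function along the axis are those of the profile [u]. *)
Lemma radial_profile_derivable (R : realType) (n : nat) (i0 : 'I_n) (eps : R)
    (u : R -> R) :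
  0 <= eps ->
  smooth_on [set x : 'rV[R]_n | eps < pole_dist x] (fun x => u (pole_dist x)) ->
  forall r : R, eps < r -> derivable u r 1 /\ derivable (derive1 u) r 1.
Proof.
move=> eps0 u_smooth.
pose e : 'rV[R]_n := delta_mx 0 i0.
pose g (x : 'rV[R]_n) := u (pole_dist x).
have axisE r : eps < r -> pole_dist (0 + r *: e) = r.
  by move=> er; rewrite add0r pole_dist_axis ger0_norm // ltW // (le_lt_trans eps0).
have axis_derive (f : 'rV[R]_n -> R) (k : R -> R) r : eps < r ->
    differentiable f (r *: e) -> (forall s, eps < s -> f (s *: e) = k s) ->
    is_derive r 1 k ('D_e f (r *: e)).
  move=> er df fk.
  have := derivableP (@diff_derivable _ _ _ f (r *: e) e df).
  rewrite -{1}[r *: e]add0r => /is_derive_line; apply: near_eq_is_derive.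
  by apply: filterS (near_gt er) => s /fk <-; rewrite add0r.
have u_derive r : eps < r -> is_derive r 1 u ('D_e g (r *: e)).
  move=> er; apply: axis_derive => //.
    by apply: (u_smooth [::]); rewrite /= -[r *: e]add0r axisE.
  by move=> s es; rewrite /g -[s *: e]add0r axisE.
move=> r er; split; first by have [] := u_derive r er.
have [] // : is_derive r 1 (derive1 u) ('D_e ('D_e g) (r *: e)).
apply: axis_derive => //.
  by apply: (u_smooth [:: e]); rewrite /= -[r *: e]add0r axisE.
by move=> s es; rewrite derive1E; have [_ ->] := u_derive s es.
Qed.
(** * The product metric *)

Section RadialProjection.
Variables (R : realType) (n : nat).
Implicit Types (x : 'rV[R]_n) (a b : R).

(** Away from the pole this is the Euclidean orthogonal projection onto the line of [x]; at the pole
    it is the zero matrix. *)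
Definition radial_proj x : 'M[R]_n := (pole_dist x ^+ 2)^-1 *: (x^T *m x).

(** Off the pole, the identity on the radial line and multiplication by [a] on its orthogonal
    complement. Such matrices multiply like their factors [a], which yields the inverse metric. *)
Definition radial_scaling x a : 'M[R]_n :=
  radial_proj x + a *: (1%:M - radial_proj x).

Lemma mulmx_row_tr x : x *m x^T = (pole_dist x ^+ 2)%:M.
Proof.
apply/matrixP => i j; rewrite !ord1 !mxE eqxx mulr1n sqr_sqrtr.
  by apply: eq_bigr => k _; rewrite !mxE expr2.
by apply: sumr_ge0 => k _; rewrite sqr_ge0.
Qed.

Lemma mulmx_radial_proj x : 0 < pole_dist x -> x *m radial_proj x = x.
Proof.
move=> x0; rewrite -scalemxAr mulmxA mulmx_row_tr mul_scalar_mx scalerA.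
by rewrite mulVf ?scale1r // sqrf_eq0 gt_eqF.
Qed.

Lemma radial_proj_idem x : 0 < pole_dist x ->
  radial_proj x *m radial_proj x = radial_proj x.
Proof. by move=> x0; rewrite -[in LHS]scalemxAl -mulmxA mulmx_radial_proj. Qed.

Lemma mulmx_radial_scaling x a : 0 < pole_dist x -> x *m radial_scaling x a = x.
Proof.
move=> x0; rewrite mulmxDr mulmx_radial_proj // -scalemxAr mulmxBr mulmx1.
by rewrite mulmx_radial_proj // subrr scaler0 addr0.
Qed.

Lemma tr_radial_scaling x a : (radial_scaling x a)^T = radial_scaling x a.
Proof.
have trP : (radial_proj x)^T = radial_proj x.
  by rewrite /radial_proj linearZ /= trmx_mul trmxK.
rewrite /radial_scaling; move: (radial_proj x) trP => P trP.
by rewrite linearD linearZ linearB /= trmx1 trP.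
Qed.

Lemma radial_scalingM x a b : 0 < pole_dist x ->
  radial_scaling x a *m radial_scaling x b = radial_scaling x (a * b).
Proof.
move=> /radial_proj_idem; rewrite /radial_scaling; move: (radial_proj x) => P PP.
have PQ : P *m (1%:M - P) = 0 by rewrite mulmxBr mulmx1 PP subrr.
have QP : (1%:M - P) *m P = 0 by rewrite mulmxBl mul1mx PP subrr.
have QQ : (1%:M - P) *m (1%:M - P) = 1%:M - P by rewrite mulmxBl mul1mx PQ subr0.
rewrite mulmxDl !mulmxDr -!scalemxAl -!scalemxAr PP PQ QP QQ.
by rewrite !scaler0 addr0 add0r scalerA.
Qed.

Lemma radial_scaling1 x : radial_scaling x 1 = 1%:M.
Proof. by rewrite /radial_scaling scale1r addrC subrK. Qed.

Lemma radial_scaling_axis (i0 : 'I_n) (r a : R) (i j : 'I_n) : 0 < r ->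
  radial_scaling (r *: delta_mx 0 i0) a i j =
  if i == j then if i == i0 then 1 else a else 0.
Proof.
move=> r0; have -> : radial_scaling (r *: delta_mx 0 i0) a =
    delta_mx i0 i0 + a *: (1%:M - delta_mx i0 i0).
  rewrite /radial_scaling; have -> // : radial_proj (r *: delta_mx 0 i0) = delta_mx i0 i0.
  rewrite /radial_proj pole_dist_axis gtr0_norm // -scalemxAr [_^T]linearZ /=.
  rewrite -scalemxAl trmx_delta mul_delta_mx !scalerA -expr2.
  by rewrite mulVf ?scale1r // sqrf_eq0 gt_eqF.
rewrite !mxE; have [<-|ij] := eqVneq i j.
  by rewrite andbb; case: eqP => _; rewrite /= ?subrr ?mulr0 ?addr0 ?subr0 ?mulr1 ?add0r.
have [ii0|_] /= := eqVneq i i0; last by rewrite subrr mulr0 addr0.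
by rewrite eq_sym -ii0 (negbTE ij) subrr mulr0 addr0.
Qed.

End RadialProjection.

Section ProductMetric.
Variables (R : realType) (n : nat) (xi : R -> R).
Implicit Types (p q : 'rV[R]_(n + 1)).

Definition warping (r : R) : R := if r == 0 then 1 else (xi r / r) ^+ 2.

Lemma product_metricE p : product_metric xi p =
  block_mx (radial_scaling (base p) (warping (Defs.radius p))) 0 0 1%:M.
Proof. by []. Qed.

Lemma tr_product_metric p : (product_metric xi p)^T = product_metric xi p.
Proof. by rewrite product_metricE tr_block_mx !trmx0 trmx1 tr_radial_scaling. Qed.

Lemma warping_gt0 r : (forall s : R, 0 < s -> 0 < xi s) -> 0 < r -> 0 < warping r.
Proof. by move=> xi0 r0; rewrite /warping gt_eqF // exprn_gt0 // divr_gt0 // xi0. Qed.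

Hypothesis xi_gt0 : forall s : R, 0 < s -> 0 < xi s.

Lemma mul_product_metricV p : 0 < Defs.radius p ->
  product_metric xi p *m
    block_mx (radial_scaling (base p) (warping (Defs.radius p))^-1) 0 0 1%:M = 1%:M.
Proof.
move=> r0; rewrite product_metricE mulmx_block !(mulmx0, mul0mx, mulmx1, addr0, add0r).
rewrite radial_scalingM // mulfV ?radial_scaling1 -?scalar_mx_block //.
by rewrite gt_eqF // warping_gt0.
Qed.

Lemma product_metric_unit p : 0 < Defs.radius p -> product_metric xi p \in unitmx.
Proof. by move=> /mul_product_metricV/mulmx1_unit[]. Qed.

Lemma invmx_product_metric p : 0 < Defs.radius p ->
  invmx (product_metric xi p) =
  block_mx (radial_scaling (base p) (warping (Defs.radius p))^-1) 0 0 1%:M.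
Proof.
move=> r0; have GV := mul_product_metricV r0.
by rewrite -[RHS]mul1mx -(mulVmx (product_metric_unit r0)) -mulmxA GV mulmx1.
Qed.

(** The metric agrees with the Euclidean one on radial and vertical vectors, so gradients of
    functions of [r] and [t] are computed as in Euclidean space. *)
Lemma mul_product_metric_radial p (b : R) : 0 < Defs.radius p ->
  row_mx (b *: base p) 1%:M *m product_metric xi p = row_mx (b *: base p) 1%:M.
Proof.
move=> r0; rewrite product_metricE mul_row_block !(mulmx0, mulmx1, addr0, add0r).
by rewrite -scalemxAl mulmx_radial_scaling.
Qed.

End ProductMetric.

(** A gradient can thus be verified through the equation [w G = df], without computing the inverse
    metric. Symmetry reconciles row and column conventions. *)
Lemma gradientE (R : realType) (m : nat) (G : 'rV[R]_m -> 'M[R]_m)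
    (f : 'rV[R]_m -> R) (p w : 'rV[R]_m) :
  (G p)^T = G p -> G p \in unitmx -> w *m G p = \row_l partial l f p ->
  gradient G f p = w.
Proof.
move=> G_sym G_unit wG.
rewrite -[w]mulmx1 -(mulmxV G_unit) mulmxA wG.
apply/rowP => k; rewrite !mxE; apply: eq_bigr => l _; rewrite !mxE mulrC.
by rewrite -{1}G_sym -trmx_inv mxE.
Qed.

(* [d_j log (sqrt (det G))], by Jacobi's formula. *)
Definition log_volume_partial (R : realType) (m : nat)
    (G : 'rV[R]_m -> 'M[R]_m) (p : 'rV[R]_m) (j : 'I_m) : R :=
  2^-1 * \sum_k \sum_l invmx (G p) k l * partial j (fun q => G q k l) p.

Lemma divergenceE (R : realType) (m : nat) (G : 'rV[R]_m -> 'M[R]_m)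
    (Y : 'rV[R]_m -> 'rV[R]_m) (p : 'rV[R]_m) :
  (forall q, (G q)^T = G q) ->
  \sum_k nabla G (delta_mx 0 k) Y p 0 k =
  \sum_k partial k (fun q => Y q 0 k) p +
  \sum_j Y p 0 j * log_volume_partial G p j.
Proof.
move=> G_sym.
have G_symE k l : (fun q => G q k l) = (fun q => G q l k).
  by apply/funext => q; rewrite -{1}G_sym mxE.
have inv_sym k l : invmx (G p) k l = invmx (G p) l k.
  by rewrite -{1}(G_sym p) -trmx_inv mxE.
transitivity (\sum_k (partial k (fun q => Y q 0 k) p +
    \sum_j christoffel G p k k j * Y p 0 j)).
  apply: eq_bigr => k _; rewrite mxE (bigD1 k) //= mxE !eqxx mul1r.
  rewrite [X in _ + X]big1 ?addr0 // => i ik.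
  by rewrite mxE (negbTE ik) andbF mul0r.
rewrite big_split /=; congr (_ + _); rewrite exchange_big /=.
apply: eq_bigr => j _; rewrite -mulr_suml mulrC; congr (_ * _).
rewrite /christoffel -mulr_sumr; congr (_ * _).
(* Of the three terms of the traced Christoffel symbol, the first and the third cancel after
   exchanging [k] and [l], by symmetry of the metric and of its inverse. *)
pose D i k l := partial i (fun q => G q k l) p.
rewrite (eq_bigr (fun k => \sum_l invmx (G p) k l * D k j l +
    \sum_l invmx (G p) k l * D j k l - \sum_l invmx (G p) k l * D l k j)).
  rewrite sumrB big_split /= addrAC [X in X - _ + _](_ : _ = \sum_k \sum_l
    invmx (G p) k l * D l k j); first by rewrite subrr add0r.
  rewrite exchange_big /=; apply: eq_bigr => k _; apply: eq_bigr => l _.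
  by rewrite inv_sym /D G_symE.
by move=> k _; rewrite -big_split -sumrB /=; apply: eq_bigr => l _; rewrite mulrBr mulrDr.
Qed.
(** * Mean curvature of radial graphs *)

Lemma is_derive_coord (R : realType) (m : nat) (j : 'I_m) (x v : 'rV[R]_m) :
  is_derive x v (fun y : 'rV[R]_m => y 0 j) (v 0 j).
Proof.
apply/is_derive_line0.
rewrite (_ : (fun t => _) = cst (x 0 j) + (fun t : R => t) * cst (v 0 j)).
  apply: (is_derive_eq (is_deriveD (is_derive_cst _ _ _)
    (is_deriveM (is_derive_id _ _) (is_derive_cst _ _ _)))).
  by rewrite add0r scaler0 add0r [_ *: 1]mulr1.
by apply/funext => t; rewrite !fctE !mxE.
Qed.

(** Every iterated derivative of a coordinate is the coordinate itself or a constant. *)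
Lemma smooth_on_coord (R : realType) (m : nat) (D : set 'rV[R]_m) (j : 'I_m) :
  smooth_on D (fun x => x 0 j).
Proof.
move=> s x _.
pose Dseq (s : seq 'rV[R]_m) : 'rV[R]_m -> R :=
  foldr (fun v (k : 'rV[R]_m -> R) => 'D_v k) (fun x => x 0 j) s.
suff [E|[a E]] : Dseq s = (fun x => x 0 j) \/ exists a, Dseq s = cst a.
- have := differentiable_coord x 0 j.
  by rewrite -[X in differentiable X _ -> _]E; apply.
- have := @differentiable_cst R _ R a x.
  by rewrite -[X in differentiable X _ -> _]E; apply.
elim: s => [|v s IH]; [by left|right; rewrite (_ : Dseq (v :: s) = 'D_v (Dseq s)) //].
case: IH => [->|[a ->]].
  by exists (v 0 j); apply/funext => y; have [_ ->] := is_derive_coord j y v.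
by exists 0; apply/funext => y; rewrite derive_cst.
Qed.

Lemma is_derive_pole_dist (R : realType) (n : nat) (x v : 'rV[R]_n) :
  0 < pole_dist x ->
  is_derive x v (@pole_dist R n) ((\sum_i x 0 i * v 0 i) / pole_dist x).
Proof.
rewrite /pole_dist => x0; set N := \sum_i _ ^+ 2.
have N0 : 0 < N by rewrite -sqrtr_gt0.
apply: (@is_derive_eq _ _ _ _ _ _ _ ((2 * Num.sqrt N)^-1 * \sum_i 2 * x 0 i * v 0 i)).
  apply: (is_derive_outer_comp (f := fun x : 'rV[R]_n => \sum_i x 0 i ^+ 2)).
    rewrite (_ : (fun y : 'rV[R]_n => _) = \sum_i (fun y : 'rV[R]_n => y 0 i) ^+ 2).
      apply: is_derive_sum => i; have ? := is_derive_coord i x v.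
      by apply: is_derive_eq; rewrite expr1.
    by apply/funext => y; rewrite fct_sumE.
  exact: is_derive1_sqrt.
under eq_bigr do rewrite -mulrA.
rewrite -mulr_sumr; field; rewrite gt_eqF //.
Qed.

Lemma is_derive_radius (R : realType) (n : nat) (q v : 'rV[R]_(n + 1)) :
  0 < Defs.radius q ->
  is_derive q v (@Defs.radius R n)
    ((\sum_i base q 0 i * base v 0 i) / Defs.radius q).
Proof.
move=> q0; apply/is_derive_line0.
rewrite (_ : (fun t => _) = (fun t => pole_dist (base q + t *: base v))).
  by apply/(is_derive_line0 (@pole_dist R n)); exact: is_derive_pole_dist.
by apply/funext => t; rewrite /Defs.radius /base linearD linearZ.
Qed.

Lemma base_continuous (R : realType) (n : nat) : continuous (@base R n).
Proof. by move=> q; apply: differentiable_continuous; exact: differentiable_lsubmx. Qed.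

Lemma radius_continuous (R : realType) (n : nat) : continuous (@Defs.radius R n).
Proof.
move=> q; apply: continuous_comp; first exact: base_continuous.
exact: pole_dist_continuous.
Qed.

Lemma heightE (R : realType) (n : nat) (q : 'rV[R]_(n + 1)) :
  height q = q 0 (rshift n 0).
Proof. by rewrite /height mxE. Qed.

Lemma base_lshift (R : realType) (n : nat) (i : 'I_n) :
  base (delta_mx 0 (lshift 1 i) : 'rV[R]_(n + 1)) = delta_mx 0 i.
Proof. by apply/rowP => j; rewrite !mxE (inj_eq (@lshift_inj _ _)). Qed.

Lemma base_rshift (R : realType) (n : nat) (i : 'I_1) :
  base (delta_mx 0 (rshift n i) : 'rV[R]_(n + 1)) = 0.
Proof. by apply/rowP => j; rewrite !mxE eq_lrshift andbF. Qed.

Lemma sum_mul_delta (R : realType) (n : nat) (x : 'rV[R]_n) (i : 'I_n) :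
  \sum_j x 0 j * (delta_mx 0 i : 'rV[R]_n) 0 j = x 0 i.
Proof.
rewrite (bigD1 i) //= mxE !eqxx mulr1 big1 ?addr0 // => j ji.
by rewrite mxE (negbTE ji) mulr0.
Qed.

Section GraphNormal.
Variables (R : realType) (n : nat) (xi : R -> R).
Hypothesis xi_gt0 : forall s : R, 0 < s -> 0 < xi s.
Variable u : R -> R.

Definition graph_defining (q : 'rV[R]_(n + 1)) : R := height q - u (Defs.radius q).

Lemma partial_graph_defining q (du : R) : 0 < Defs.radius q ->
  is_derive (Defs.radius q) 1 u du ->
  \row_l partial l graph_defining q = row_mx (- (du / Defs.radius q) *: base q) 1%:M.
Proof.
move=> q0 u_du.
have f_df v : is_derive q v graph_defining
    (v 0 (rshift n 0) - du * ((\sum_i base q 0 i * base v 0 i) / Defs.radius q)).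
  rewrite (_ : graph_defining =
      (fun q : 'rV[R]_(n + 1) => q 0 (rshift n 0)) - (u \o @Defs.radius R n)).
    have ? := is_derive_coord (rshift n 0) q v.
    have ? := is_derive_outer_comp (is_derive_radius v q0) u_du.
    exact: is_deriveB.
  by apply/funext => x; rewrite /graph_defining heightE.
apply/rowP => l; rewrite mxE /partial; have [_ ->] := f_df (delta_mx 0 l).
case: (split_ordP l) => i ->.
  rewrite base_lshift sum_mul_delta row_mxEl !mxE eq_rlshift andbF.
  by rewrite sub0r mulNr mulrA mulrAC.
rewrite base_rshift row_mxEr !ord1 big1 => [|j _]; last by rewrite [X in _ * X]mxE mulr0.
by rewrite mul0r mulr0 subr0 !mxE !eqxx.
Qed.

(** The gradient has squared length [1 + du ^+ 2]: its radial part is a multiple of [base q], a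
    vector of length [r], which explains the division by the radius. *)
Lemma unit_normal_graph q (du : R) : 0 < Defs.radius q ->
  is_derive (Defs.radius q) 1 u du ->
  let W := Num.sqrt (1 + du ^+ 2) in
  unit_normal (product_metric xi) graph_defining q =
  row_mx (- (du / (Defs.radius q * W)) *: base q) (W^-1)%:M.
Proof.
move=> q0 u_du W; rewrite /unit_normal.
rewrite (@gradientE _ _ _ _ _ (row_mx (- (du / Defs.radius q) *: base q) 1%:M)); last first.
- by rewrite mul_product_metric_radial // (partial_graph_defining q0 u_du).
- exact: product_metric_unit.
- exact: tr_product_metric.
rewrite /inner mul_product_metric_radial // tr_row_mx mul_row_col.
rewrite [(_ *: base q)^T]linearZ /= -scalemxAl -scalemxAr mulmx_row_tr trmx1 mulmx1.
rewrite [X in Num.sqrt X](_ : _ = 1 + du ^+ 2); last first.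
  rewrite !mxE !eqxx !mulr1n -/(Defs.radius q); field; rewrite gt_eqF //.
rewrite -/W scale_row_mx scalerA scale_scalar_mx mulr1; congr (row_mx (_ *: _) _).
by rewrite !invfM mulrN; congr (- _); rewrite mulrC -mulrA.
Qed.

End GraphNormal.

(** * Divergence of the unit normal along a coordinate axis *)

Section RadialOde.
Variables (R : realType) (n : nat) (i0 : 'I_n) (xi : R -> R).
Hypothesis xi_gt0 : forall s : R, 0 < s -> 0 < xi s.

(** Test points at which the metric is diagonal for positive [r]; each radius and height is
    represented by one of them. *)
Definition axis_point (r t : R) : 'rV[R]_(n + 1) :=
  row_mx (r *: delta_mx 0 i0) t%:M.

Lemma base_axis_point r t : base (axis_point r t) = r *: delta_mx 0 i0.
Proof. by rewrite /base row_mxKl. Qed.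

Lemma height_axis_point r t : height (axis_point r t) = t.
Proof. by rewrite /height row_mxKr mxE eqxx. Qed.

Lemma radius_axis_point (r t : R) : 0 <= r -> Defs.radius (axis_point r t) = r.
Proof. by move=> r0; rewrite /Defs.radius base_axis_point pole_dist_axis ger0_norm. Qed.

Lemma axis_point_shift r t s :
  axis_point r t + s *: delta_mx 0 (lshift 1 i0) = axis_point (r + s) t.
Proof.
apply/rowP => l; rewrite !mxE; case: (split_ordP l) => i ->.
  by rewrite !mxE (inj_eq (@lshift_inj _ _)) mulrDl.
by rewrite eq_rlshift andbF mulr0 addr0.
Qed.

Lemma axis_point_lift r t s :
  axis_point r t + s *: delta_mx 0 (rshift n 0) = axis_point r (t + s).
Proof.
apply/rowP => l; rewrite !mxE; case: (split_ordP l) => i ->.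
  by rewrite eq_lrshift andbF mulr0 addr0.
by rewrite !ord1 !mxE !eqxx mulr1.
Qed.

Lemma metric_axis_point (r t : R) k l : 0 < r ->
  product_metric xi (axis_point r t) k l =
  if k == l then
    match fintype.split k with
    | inl i => if i == i0 then 1 else warping xi r
    | inr _ => 1
    end
  else 0.
Proof.
move=> r0; rewrite product_metricE radius_axis_point ?ltW // base_axis_point.
case: (split_ordP k) => i ->; case: (split_ordP l) => j ->.
- by rewrite block_mxEul radial_scaling_axis // (inj_eq (@lshift_inj _ _)).
- by rewrite block_mxEur mxE eq_lrshift.
- by rewrite block_mxEdl mxE eq_rlshift.
- by rewrite block_mxEdr !ord1 mxE !eqxx.
Qed.

Lemma invmx_metric_axis_point (r t : R) k l : 0 < r ->
  invmx (product_metric xi (axis_point r t)) k l =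
  if k == l then
    match fintype.split k with
    | inl i => if i == i0 then 1 else (warping xi r)^-1
    | inr _ => 1
    end
  else 0.
Proof.
move=> r0; rewrite invmx_product_metric ?radius_axis_point ?ltW // base_axis_point.
case: (split_ordP k) => i ->; case: (split_ordP l) => j ->.
- by rewrite block_mxEul radial_scaling_axis // (inj_eq (@lshift_inj _ _)).
- by rewrite block_mxEur mxE eq_lrshift.
- by rewrite block_mxEdl mxE eq_rlshift.
- by rewrite block_mxEdr !ord1 mxE !eqxx.
Qed.

Lemma log_volume_vertical (r t : R) : 0 < r ->
  log_volume_partial (product_metric xi) (axis_point r t) (rshift n 0) = 0.
Proof.
move=> r0; rewrite /log_volume_partial big1 ?mulr0 // => k _; rewrite big1 // => l _.
rewrite [partial _ _ _](_ : _ = 0) ?mulr0 //.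
suff [] : is_derive (axis_point r t) (delta_mx 0 (rshift n 0))
  (fun q => product_metric xi q k l) 0 by [].
apply/is_derive_line0.
rewrite (_ : (fun t => _) = cst (product_metric xi (axis_point r t) k l)).
  exact: is_derive_cst.
apply/funext => s; rewrite /cst axis_point_lift.
exact: etrans (metric_axis_point (t + s) k l r0) (esym (metric_axis_point t k l r0)).
Qed.

Lemma is_derive_warping (r dxi : R) : 0 < r -> is_derive r 1 xi dxi ->
  is_derive r 1 (warping xi) (2 * (dxi / xi r - r^-1) * warping xi r).
Proof.
move=> r0 xi_dxi; have xir := xi_gt0 r0.
have ? : is_derive r 1 (fun s : R => s^-1) (- r ^- 2 *: 1).
  by apply: is_deriveV; rewrite ?gt_eqF.
apply: (@near_eq_is_derive _ _ _ ((xi * (fun s : R => s^-1)) ^+ 2)).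
  by apply: filterS (near_gt r0) => s s0; rewrite /warping gt_eqF.
apply: is_derive_eq; rewrite /GRing.scale /warping /= gt_eqF // expr1 !fctE.
by field; rewrite !gt_eqF.
Qed.

(** The volume density in Cartesian coordinates is [(xi r / r)^(n - 1)]: each of the [n - 1]
    tangential directions contributes the logarithmic derivative of [xi r / r]. *)
Lemma log_volume_radial (r t dxi : R) : 0 < r -> is_derive r 1 xi dxi ->
  log_volume_partial (product_metric xi) (axis_point r t) (lshift 1 i0) =
  n.-1%:R * (dxi / xi r - r^-1).
Proof.
move=> r0 xi_dxi; set D := dxi / xi r - r^-1.
have diag_derive k : partial (lshift 1 i0) (fun q => product_metric xi q k k)
    (axis_point r t) =
    match fintype.split k with
    | inl i => if i == i0 then 0 else 2 * D * warping xi r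
    | inr _ => 0
    end.
  set d := RHS.
  suff [] : is_derive (axis_point r t) (delta_mx 0 (lshift 1 i0))
    (fun q => product_metric xi q k k) d by [].
  apply/is_derive_line0.
  pose g (s : R) : R := match fintype.split k with
    | inl i => if i == i0 then 1 else warping xi s
    | inr _ => 1
    end.
  apply: (@near_eq_is_derive R R R (fun s => g (r + s *: (1 : R)))).
    (* The diagonal form of the metric requires [0 < r + s], so it is available for [s] near [0]. *)
    have /near_gt : - r < 0 by rewrite oppr_lt0.
    apply: filterS => s rs; rewrite [s *: 1]mulr1 axis_point_shift.
    by rewrite metric_axis_point ?eqxx // -ltrBlDl sub0r.
  apply/(is_derive_line0 g); rewrite /g /d.
  case: (fintype.split k) => [i|_]; last exact: is_derive_cst.
  by case: (i == i0); [exact: is_derive_cst|exact: is_derive_warping].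
(* The inverse metric is diagonal on the axis, so derivatives of off-diagonal entries of the metric
   never have to be computed. *)
have offdiag k l : l != k -> invmx (product_metric xi (axis_point r t)) k l = 0.
  by move=> lk; rewrite invmx_metric_axis_point // eq_sym (negbTE lk).
rewrite /log_volume_partial; under eq_bigr => k _.
  rewrite (bigD1 k) //= [X in _ + X]big1 => [|l lk]; last by rewrite offdiag ?mul0r.
  rewrite addr0 diag_derive invmx_metric_axis_point // eqxx.
  over.
rewrite big_split_ord /= [X in _ + X]big1 => [|i _]; last first.
  by case: split_ordP => j => [/esym/eqP|_]; rewrite ?eq_lrshift ?mulr0.
under eq_bigr => i _.
  rewrite (unsplitK (inl i)).
  over.
rewrite (bigD1 i0) //= eqxx mulr0 add0r addr0.
rewrite (eq_bigr (fun=> 2 * D)) => [|i ii0]; last first.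
  by rewrite (negbTE ii0); field; rewrite gt_eqF // warping_gt0.
by rewrite sumr_const cardC1 card_ord -mulr_natl; field.
Qed.

Lemma sum_axis_row (a r : R) (b : 'M[R]_1) (L : 'I_(n + 1) -> R) :
  \sum_j row_mx (a *: (r *: delta_mx 0 i0)) b 0 j * L j =
  a * r * L (lshift 1 i0) + b 0 0 * L (rshift n 0).
Proof.
rewrite big_split_ord /= big_ord1 row_mxEr; congr (_ + _).
rewrite (bigD1 i0) //= big1 ?addr0 => [|i ii0]; last first.
  by rewrite row_mxEl !mxE (negbTE ii0) andbF !mulr0 mul0r.
by rewrite row_mxEl !mxE !eqxx mulr1.
Qed.

(** The base part of the normal is [F(r) x], with coordinate divergence [n F + r F']. The [- 1 / r]
    in the logarithmic volume derivative removes [(n - 1) F], which leaves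
    [(r F)' + (n - 1) (xi' / xi) r F] with [r F = - u' / W]. *)
Lemma graph_divergence_axis (u : R -> R) (eps r t dxi d2u : R) :
  0 <= eps -> eps < r -> is_derive r 1 xi dxi ->
  (forall s, eps < s -> derivable u s 1) ->
  is_derive r 1 (derive1 u) d2u ->
  let W := Num.sqrt (1 + derive1 u r ^+ 2) in
  \sum_k nabla (product_metric xi) (delta_mx 0 k)
     (unit_normal (product_metric xi) (graph_defining u)) (axis_point r t) 0 k =
  - (d2u / W ^+ 3 + n.-1%:R * (dxi / xi r) * (derive1 u r / W)).
Proof.
move=> eps0 er xi_dxi u_der u_d2u W.
have r0 : 0 < r by apply: le_lt_trans er.
pose p := axis_point r t.
have radp : Defs.radius p = r by rewrite radius_axis_point ?ltW.
pose N (s : R) := (Num.sqrt (1 + derive1 u s ^+ 2))^-1.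
pose F (s : R) := - (derive1 u s / (s * Num.sqrt (1 + derive1 u s ^+ 2))).
have normalE q : eps < Defs.radius q ->
    unit_normal (product_metric xi) (graph_defining u) q =
    row_mx (F (Defs.radius q) *: base q) (N (Defs.radius q))%:M.
  move=> eq; apply: unit_normal_graph => //; first exact: le_lt_trans eq.
  by rewrite derive1E; apply: derivableP; exact: u_der.
have near_p : \near p, eps < Defs.radius p.
  have := @radius_continuous R n p [set s | eps < s]; apply.
  by apply: near_gt; rewrite radp.
rewrite divergenceE; last exact: tr_product_metric.
have D0 : 0 < 1 + derive1 u r ^+ 2 by rewrite ltr_pwDl ?sqr_ge0.
have W0 : 0 < W by rewrite sqrtr_gt0.
have W2 : W ^+ 2 = 1 + derive1 u r ^+ 2 by rewrite sqr_sqrtr // ltW.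
have S_dS : is_derive r 1 (fun s => Num.sqrt (1 + derive1 u s ^+ 2))
    (derive1 u r * d2u / W).
  pose g := cst 1 + (derive1 u) ^+ 2.
  have g_dg : is_derive r 1 g (2 * derive1 u r * d2u).
    apply: (is_derive_eq (is_deriveD (is_derive_cst (1 : R) r 1) (is_deriveX 2 u_d2u))).
    by rewrite add0r expr1.
  apply: (is_derive_eq (@is_derive1_comp _ Num.sqrt g r _ _ (is_derive1_sqrt D0) g_dg)).
  by rewrite -/W; field; rewrite gt_eqF.
have N_dN : is_derive r 1 N (- (derive1 u r * d2u / W ^+ 3)).
  apply: (is_derive_eq (is_deriveV _ S_dS)); first by rewrite gt_eqF.
  rewrite /GRing.scale /= -/W; field; rewrite gt_eqF //.
pose dF := - (d2u / (r * W ^+ 3)) + derive1 u r / (r ^+ 2 * W).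
have F_dF : is_derive r 1 F dF.
  have ? : is_derive r 1 (fun s : R => s^-1) (- r ^- 2 *: 1).
    by apply: is_deriveV; rewrite ?gt_eqF.
  have -> : F = - (derive1 u * ((fun s : R => s^-1) * N)).
    by apply/funext => s; rewrite /F /N !fctE invfM.
  apply: is_derive_eq; rewrite /GRing.scale /dF /= !fctE /N -/W.
  (* The inserted factor equals [1]. With it the identity holds for [W] as an independent variable,
     so [field] can close it. *)
  have -> : d2u / (r * W ^+ 3) = d2u * (W ^+ 2 - derive1 u r ^+ 2) / (r * W ^+ 3).
    by rewrite W2 addrK mulr1.
  by field; rewrite !gt_eqF.
have nuE : unit_normal (product_metric xi) (graph_defining u) p =
    row_mx (F r *: (r *: delta_mx 0 i0)) (N r)%:M.
  by rewrite normalE radp // base_axis_point.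
(* The radius is stationary in the directions orthogonal to the axis, so [dF] enters only for [i0];
   the vertical component does not depend on the height. *)
have partial_nu k : partial k (fun q =>
      unit_normal (product_metric xi) (graph_defining u) q 0 k) p =
    match fintype.split k with
    | inl i => F r + (if i == i0 then r * dF else 0)
    | inr _ => 0
    end.
  set d := RHS; suff [] : is_derive p (delta_mx 0 k) (fun q =>
      unit_normal (product_metric xi) (graph_defining u) q 0 k) d by [].
  rewrite /d; case: (split_ordP k) => i -> {d}.
    apply: (@near_eq_is_derive _ _ _ ((F \o @Defs.radius R n) *
        (fun q : 'rV[R]_(n + 1) => q 0 (lshift 1 i)))).
      by apply: filterS near_p => q /normalE ->; rewrite row_mxEl !mxE.
    have ? := is_derive_coord (lshift 1 i) p (delta_mx 0 (lshift 1 i)).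
    have rp := @is_derive_radius R n p (delta_mx 0 (lshift 1 i)).
    rewrite radp base_lshift sum_mul_delta base_axis_point in rp.
    rewrite -radp in F_dF; have ? := is_derive_outer_comp (rp r0) F_dF.
    apply: is_derive_eq; rewrite /GRing.scale /= radp row_mxEl !mxE !eqxx.
    by case: (i == i0); rewrite /= ?mulr1 ?mulr0 ?mul0r ?mulfV ?mulr1 // gt_eqF.
  apply: (@near_eq_is_derive _ _ _ (N \o @Defs.radius R n)).
    by apply: filterS near_p => q /normalE ->; rewrite row_mxEr !mxE !ord1 eqxx.
  have rp := @is_derive_radius R n p (delta_mx 0 (rshift n i)).
  rewrite radp base_rshift in rp.
  rewrite -radp in N_dN; have ? := is_derive_outer_comp (rp r0) N_dN.
  apply: is_derive_eq; rewrite big1 ?mul0r ?mulr0 // => j _.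
  by rewrite [X in _ * X]mxE mulr0.
rewrite (eq_bigr _ (fun k _ => partial_nu k)).
rewrite big_split_ord /= [X in _ + X + _]big1 ?addr0; last first.
  by move=> i _; rewrite (unsplitK (inr i)).
rewrite (eq_bigr (fun i => F r + (if i == i0 then r * dF else 0))); last first.
  by move=> i _; rewrite (unsplitK (inl i)).
rewrite big_split /= sumr_const card_ord -big_mkcond big_pred1_eq /=.
rewrite nuE sum_axis_row.
rewrite (log_volume_radial t r0 xi_dxi) (log_volume_vertical t r0) !mulr0 addr0.
have nE : n%:R = 1 + n.-1%:R :> R by case: n i0 => [[]|m _] //; rewrite -natr1 addrC.
rewrite -[F r *+ n]mulr_natl nE /F -/W /dF.
by field; rewrite !gt_eqF // xi_gt0.
Qed.

End RadialOde.
(** * The soliton equation *)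

Section RotationalSoliton.
Variables (R : realType) (n : nat) (i0 : 'I_n) (c : R) (xi : R -> R).
Hypothesis hxi : rotational_profile xi.

Lemma profile_is_derive (r : R) : is_derive r 1 xi (derive1 xi r).
Proof. by rewrite derive1E; apply: derivableP; exact: (@profile_smooth _ _ hxi 0%N). Qed.

Lemma profile_is_derive2 (r : R) : is_derive r 1 (derive1 xi) (derive1n 2 xi r).
Proof.
rewrite (derive1nS xi 1) derive1n1 derive1E; apply: derivableP.
exact: (@profile_smooth _ _ hxi 1%N).
Qed.

(** The equation is local, so it is enough that [M] coincides with the graph inside an open set [U].
    This covers the bowl and each single sheet of a winglike soliton. *)
Lemma soliton_graph_ode (eps : R) (u : R -> R) (M U : set 'rV[R]_(n + 1)) :
  0 <= eps ->
  smooth_on [set x : 'rV[R]_n | eps < pole_dist x] (fun x => u (pole_dist x)) ->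
  soliton xi c M -> open U ->
  (forall q, U q -> eps < Defs.radius q) ->
  (forall q, U q -> M q <-> height q = u (Defs.radius q)) ->
  forall r : R, eps < r -> U (axis_point i0 r (u r)) ->
  is_derive r 1 (derive1 u)
    ((1 + derive1 u r ^+ 2) * (c - n.-1%:R * derive1 u r * (derive1 xi r / xi r))).
Proof.
move=> eps0 u_smooth [_ M_soliton] openU U_eps U_graph r er Up.
have u_C2 := radial_profile_derivable i0 eps0 u_smooth.
have r0 : 0 < r := le_lt_trans eps0 er.
set p := axis_point i0 r (u r) in Up.
have radp : Defs.radius p = r by rewrite radius_axis_point ?ltW.
have Mp : M p by apply/U_graph; rewrite // radp height_axis_point.
have u_du q : U q -> is_derive (Defs.radius q) 1 u (derive1 u (Defs.radius q)).
  by move=> Uq; rewrite derive1E; apply: derivableP; exact: (proj1 (u_C2 _ (U_eps q Uq))).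
have U_rad0 q : U q -> 0 < Defs.radius q.
  by move=> /U_eps; exact: le_lt_trans.
have ldf : local_defining_function M U (graph_defining u).
  split => //.
  - rewrite (_ : graph_defining u = (fun q : 'rV[R]_(n + 1) => q 0 (rshift n 0)) -
      ((fun x => u (pole_dist x)) \o lsubmx)).
      apply: smooth_onB => //; first exact: smooth_on_coord.
      apply: smooth_on_sub (smooth_on_comp_linear _ _ u_smooth).
      - exact: U_eps.
      - exact: base_continuous.
      - exact: open_pole_dist_gt.
    by apply/funext => q; rewrite /graph_defining heightE.
  - move=> q Uq; exists (rshift n 0).
    have /rowP/(_ (rshift n 0)) := partial_graph_defining (U_rad0 q Uq) (u_du q Uq).
    by rewrite mxE row_mxEr mxE eqxx => ->; exact: oner_neq0.
  - apply/seteqP; split => q [].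
    + by move=> Mq Uq; split=> //; apply/eqP; rewrite subr_eq0; apply/eqP/U_graph.
    + by move=> Uq /eqP; rewrite subr_eq0 => /eqP ?; split=> //; exact/U_graph.
have u_d2u := derivableP (proj2 (u_C2 r er)); set d2u := 'D_1 _ r in u_d2u.
have := M_soliton U _ p ldf Up Mp.
rewrite /normal_part /mean_curvature_vector.
rewrite (graph_divergence_axis i0 (profile_gt0 hxi) (u r) eps0 er
  (profile_is_derive r) _ u_d2u); last first.
  by move=> s /u_C2[].
have := @unit_normal_graph _ _ _ (profile_gt0 hxi) u p _ (U_rad0 p Up) (u_du p Up).
rewrite radp => ->; set W := Num.sqrt _.
have D0 : 0 < 1 + derive1 u r ^+ 2 by rewrite ltr_pwDl ?sqr_ge0.
have W0 : 0 < W by rewrite sqrtr_gt0.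
have W2 : W ^+ 2 = 1 + derive1 u r ^+ 2 by rewrite sqr_sqrtr // ltW.
(* The field [dt] is put in the form of a radial vector with coefficient [0], on which the metric
   acts trivially. *)
rewrite /inner /dt -(scale0r (base p)) mul_product_metric_radial ?radp //.
rewrite scale0r tr_row_mx mul_row_col mul0mx add0r mul1mx tr_scalar_mx.
(* Both sides are multiples of the normal, whose vertical component [1 / W] is nonzero, so the
   vertical component carries the whole equation. Multiplication by [W ^+ 4] then clears the
   denominators. *)
move=> /rowP/(_ (rshift n 0)); rewrite opprK !scale_row_mx !row_mxEr !mxE eqxx !mulr1n.
move=> ode; suff <- : d2u = (1 + derive1 u r ^+ 2) *
  (c - n.-1%:R * derive1 u r * (derive1 xi r / xi r)) by [].
rewrite -W2; have := congr1 (fun z => z * W ^+ 4) ode.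
have xir := profile_gt0 hxi r0.
have -> : c * (W^-1 * W^-1) * W ^+ 4 = c * W ^+ 2 by field; rewrite gt_eqF.
set k := n.-1%:R; set phi := derive1 u r; set dxi := derive1 xi r.
have -> : (d2u / W ^+ 3 + k * (dxi / xi r) * (phi / W)) * W^-1 * W ^+ 4 =
    d2u + k * (dxi / xi r) * phi * W ^+ 2 by field; rewrite !gt_eqF.
by move=> E; rewrite mulrBr [W ^+ 2 * c]mulrC E; ring.
Qed.

Lemma bowl_ode (u : R -> R) (M : set 'rV[R]_(n + 1)) :
  smooth_on setT (fun x : 'rV[R]_n => u (pole_dist x)) ->
  soliton xi c M -> M = [set p | height p = u (Defs.radius p)] ->
  forall r : R, 0 < r ->
  is_derive r 1 (derive1 u)
    ((1 + derive1 u r ^+ 2) * (c - n.-1%:R * derive1 u r * (derive1 xi r / xi r))).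
Proof.
move=> u_smooth M_soliton ME r r0.
apply: (@soliton_graph_ode 0 u M [set q | 0 < Defs.radius q]) => //.
- exact: smooth_on_sub u_smooth.
- rewrite [X in open X](_ : _ = @Defs.radius R n @^-1` [set y | 0 < y]) //.
  by apply: open_comp => [x _|]; [exact: radius_continuous|exact: open_gt].
- by move=> q _; rewrite ME.
- by rewrite /= radius_axis_point // ltW.
Qed.

Lemma open_sub_lt0 (V : normedModType R) (D : set V) (g : V -> R) :
  open D -> (forall x, D x -> {for x, continuous g}) ->
  open (D `&` [set x | g x < 0]).
Proof.
move=> openD g_cont; rewrite openE => x [Dx gx].
apply: filterI; first exact: open_nbhs_nbhs.
by apply: (g_cont x Dx [set y | y < 0]); apply: open_nbhs_nbhs; split => //; exact: open_lt.
Qed.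

(** The strict inequality [u1 < u2] lets each sheet be isolated in an open set that misses the other
    one. *)
Lemma winglike_ode (eps : R) (u1 u2 : R -> R) (M : set 'rV[R]_(n + 1)) :
  0 <= eps ->
  smooth_on [set x : 'rV[R]_n | eps < pole_dist x] (fun x => u1 (pole_dist x)) ->
  smooth_on [set x : 'rV[R]_n | eps < pole_dist x] (fun x => u2 (pole_dist x)) ->
  (forall r, eps < r -> u1 r < u2 r) ->
  soliton xi c M ->
  M = [set p | eps <= Defs.radius p /\
        (height p = u1 (Defs.radius p) \/ height p = u2 (Defs.radius p))] ->
  forall u, u = u1 \/ u = u2 -> forall r : R, eps < r ->
  is_derive r 1 (derive1 u)
    ((1 + derive1 u r ^+ 2) * (c - n.-1%:R * derive1 u r * (derive1 xi r / xi r))).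
Proof.
move=> eps0 u1_smooth u2_smooth u12 M_soliton ME u u_or r er.
pose D := [set q : 'rV[R]_(n + 1) | eps < Defs.radius q].
have openD : open D.
  rewrite [X in open X](_ : _ = @Defs.radius R n @^-1` [set y | eps < y]) //.
  by apply: open_comp => [x _|]; [exact: radius_continuous|exact: open_gt].
(* The surface t = (u1 + u2) / 2 separates the two graphs. *)
pose g (q : 'rV[R]_(n + 1)) := 2 * height q - (u1 (Defs.radius q) + u2 (Defs.radius q)).
have u_cont (v : R -> R) q : D q ->
    smooth_on [set x : 'rV[R]_n | eps < pole_dist x] (fun x => v (pole_dist x)) ->
    {for q, continuous (v \o @Defs.radius R n)}.
  move=> Dq /(_ [::] (base q) Dq) v_diff.
  apply: (@continuous_comp _ _ _ (@base R n) (fun x => v (pole_dist x))).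
    exact: base_continuous.
  exact: differentiable_continuous.
have g_cont q : D q -> {for q, continuous g}.
  move=> Dq; apply: continuousB; last by apply: continuousD; exact: u_cont.
  apply: continuousM; first exact: cst_continuous.
  rewrite (_ : @height R n = fun x => x 0 (rshift n 0)); last first.
    by apply/funext => x; rewrite heightE.
  exact: coord_continuous.
have ptE v : D (axis_point i0 r v) /\ Defs.radius (axis_point i0 r v) = r.
  by rewrite /D /= radius_axis_point // ltW // (le_lt_trans eps0).
have u12r := u12 r er.
case: u_or => ->.
- apply: (@soliton_graph_ode eps u1 M (D `&` [set q | g q < 0])) => //.
  + exact: open_sub_lt0.
  + by move=> q [].
  + move=> q [Dq gq]; rewrite ME; split => [[_ [//|h2]]|h1]; last by split; [exact: ltW|left].
    by exfalso; move: gq (u12 _ Dq); rewrite /g /= h2; lra.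
  + split; first by case: (ptE (u1 r)).
    by rewrite /= /g height_axis_point; have [_ ->] := ptE (u1 r); lra.
- apply: (@soliton_graph_ode eps u2 M (D `&` [set q | - g q < 0])) => //.
  + by apply: (open_sub_lt0 openD) => x Dx; apply: continuousN; exact: g_cont.
  + by move=> q [].
  + move=> q [Dq gq]; rewrite ME; split => [[_ [h1|//]]|h2]; last by split; [exact: ltW|right].
    by exfalso; move: gq (u12 _ Dq); rewrite /g /= h1; lra.
  + split; first by case: (ptE (u2 r)).
    by rewrite /= /g height_axis_point; have [_ ->] := ptE (u2 r); lra.
Qed.

(** * Consequences of nonpositive radial curvature *)

Hypothesis hK : forall r, 0 < r -> radial_curvature xi r <= 0.

Lemma profile_convex (r : R) : 0 < r -> 0 <= derive1n 2 xi r.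
Proof.
move=> r0; have := hK r0; rewrite /radial_curvature oppr_le0.
by rewrite pmulr_lge0 // invr_gt0 (profile_gt0 hxi).
Qed.

Lemma profile_deriv_ge1 (r : R) : 0 < r -> 1 <= derive1 xi r.
Proof.
(* The mean value theorem is used on [[0, r]], and [MVT_ray] wants the left endpoint inside an open
   ray; [xi] being defined on the whole line, the ray from [-1] serves. *)
move=> r0; have Nr : - 1 < 0 :> R by rewrite oppr_lt0.
have [z [z0 _ E]] := MVT_ray (fun r (_ : -1 < r) => profile_is_derive2 r) Nr r0.
rewrite (profile_deriv0 hxi) subr0 in E.
by rewrite -subr_ge0 E mulr_ge0 ?profile_convex // ltW.
Qed.

(** The derivative of [q] is [1 - xi xi'' / xi'^2], and convexity of [xi] makes the subtracted term
    nonnegative. Geometrically [q] is the reciprocal of the principal curvature of a geodesic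
    sphere. *)
Lemma curvature_radius_is_derive (r : R) : 0 < r ->
  let q := fun r : R => xi r / derive1 xi r in
  is_derive r 1 q (derive1 q r) /\ derive1 q r <= 1.
Proof.
move=> r0 q; have dxi1 := profile_deriv_ge1 r0.
have dxi0 : 0 < derive1 xi r by apply: lt_le_trans dxi1.
have q_dq : is_derive r 1 q (1 - xi r * derive1n 2 xi r / derive1 xi r ^+ 2).
  have ? := profile_is_derive r.
  have ? := is_deriveV (lt0r_neq0 dxi0) (profile_is_derive2 r).
  apply: (@is_derive_eq _ _ _ (xi * (fun s => (derive1 xi s)^-1))).
  by rewrite /GRing.scale /=; field; rewrite gt_eqF.
have dqE : derive1 q r = 1 - xi r * derive1n 2 xi r / derive1 xi r ^+ 2.
  by rewrite derive1E; case: q_dq.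
rewrite dqE; split=> //.
rewrite gerBl divr_ge0 ?exprn_ge0 ?mulr_ge0 ?profile_convex // ltW //.
exact: profile_gt0.
Qed.

End RotationalSoliton.

(** * Asymptotics of the solitons *)

Lemma asymptotics_of_ode (R : realType) (n : nat) (c eps : R)
    (xi h u : R -> R) :
  (2 <= n)%N -> 0 <= c -> 0 <= eps -> (0 < eps -> 0 < c) ->
  rotational_profile xi ->
  (forall r, 0 < r -> radial_curvature xi r <= 0) ->
  smooth1_on [set r | 0 < r] h -> (forall r, 0 < r -> 0 < h r) ->
  let q := fun r : R => xi r / derive1 xi r in
  little_o_infty (fun r => h r * derive1 q r)
    (fun r => Num.max (q r) (derive1 xi r / xi r)) ->
  little_o_infty (fun r => derive1 h r / h r)
    (fun r => Num.max (derive1 xi r / xi r) (q r)) ->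
  (forall r : R, eps < r -> derivable u r 1) ->
  (forall r : R, eps < r -> is_derive r 1 (derive1 u)
    ((1 + derive1 u r ^+ 2) * (c - n.-1%:R * derive1 u r * (derive1 xi r / xi r)))) ->
  soliton_asymptotics n xi h c u.
Proof.
move=> n2 c0 eps0 eps_c hxi hK h_smooth h_gt0 q o_hdq o_dh u_der u_ode.
split.
  near=> r; apply: u_der; near: r; apply: nbhs_pinfty_gt; exact: num_real.
have pos r : eps < r -> 0 < r by apply: le_lt_trans.
have xi0 := profile_gt0 hxi.
have dxi0 r : 0 < r -> 0 < derive1 xi r.
  by move=> r0; apply: lt_le_trans (profile_deriv_ge1 hxi hK r0).
have qV r : (q r)^-1 = derive1 xi r / xi r by rewrite /q invf_div.
move: c0; rewrite le_eqVlt => /orP[/eqP c0|c0].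
  (* When [c = 0] the profile is entire, so the equation holds down to the pole, where the first
     integral is evaluated. *)
  have epsE : eps = 0.
    apply/eqP; rewrite eq_le eps0 andbT leNgt; apply/negP => /eps_c.
    by rewrite -c0 ltxx.
  rewrite -c0 => e e0; near=> r.
  have r0 : 0 < r by near: r; apply: nbhs_pinfty_gt; exact: num_real.
  rewrite mul0r mul0r subr0.
  suff -> : derive1 u r = 0 by rewrite normr0 mulr_ge0 // ltW.
  apply: (@radial_minimal_const _ n.-1 (derive1 u) xi (derive1 xi)) => //.
  - by case: (n) n2 => [|[]].
  - by move=> s _; exact: profile_is_derive.
  - apply: differentiable_continuous; apply/derivable1_diffP.
    by have [] := profile_is_derive hxi 0.
  - exact: profile0.
  - move=> s s0; have := u_ode s; rewrite epsE -c0 => /(_ s0).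
    by rewrite sub0r mulrN.
have k1 : 1 <= n.-1%:R :> R by rewrite ler1n; case: (n) n2 => [|[]].
have q_gt0 (r : R) : eps < r -> 0 < q r by move=> /pos r0; rewrite divr_gt0 ?xi0 ?dxi0.
have q_dq (r : R) : eps < r -> is_derive r 1 q (derive1 q r).
  by move=> /pos r0; exact: (proj1 (curvature_radius_is_derive hxi hK r0)).
have dq_le1 (r : R) : eps < r -> derive1 q r <= 1.
  by move=> /pos r0; exact: (proj2 (curvature_radius_is_derive hxi hK r0)).
have phi_ode (r : R) : eps < r -> is_derive r 1 (derive1 u)
    ((1 + derive1 u r ^+ 2) * (c - n.-1%:R * derive1 u r / q r)).
  by rewrite qV; exact: u_ode.
have h_pos (r : R) : eps < r -> 0 < h r by move=> /pos; exact: h_gt0.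
have h_dh (r : R) : eps < r -> is_derive r 1 h (derive1 h r).
  by move=> /pos r0; rewrite derive1E; apply: derivableP; exact: (h_smooth 0%N).
have o_hdq' : little_o_infty (fun r => h r * derive1 q r)
    (fun r => Num.max (q r) (q r)^-1).
  by move=> e /o_hdq; apply: filterS => r; rewrite qV.
have o_dh' : little_o_infty (fun r => derive1 h r / h r)
    (fun r => Num.max (q r) (q r)^-1).
  by move=> e /o_dh; apply: filterS => r; rewrite qV maxC.
exact: (soliton_ode_asymptotics c0 k1 q_gt0 q_dq dq_le1 phi_ode h_pos h_dh o_hdq' o_dh').
Unshelve. all: by end_near.
Qed.

Theorem proposition2p4 (R : realType) (n : nat) (c : R) (xi h : R -> R)
  (hn : (2 <= n)%N) (hc : 0 <= c)
  (hxi : rotational_profile xi)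
  (hK : forall r, 0 < r -> radial_curvature xi r <= 0)
  (h_smooth : smooth1_on [set r | 0 < r] h)
  (h_gt0 : forall r, 0 < r -> 0 < h r) :
  let q := fun r : R => xi r / derive1 xi r in
  (* (i) *)
  little_o_infty (derive1 q)
    (fun r => Num.min (Num.max 1 (q r ^+ 2))
                      (Num.max (q r) (derive1 xi r / xi r))) ->
  (* (ii) *)
  little_o_infty (fun r => h r * derive1 q r)
    (fun r => Num.max (q r) (derive1 xi r / xi r)) ->
  (* (iii) *)
  little_o_infty (fun r => derive1 h r / h r)
    (fun r => Num.max (derive1 xi r / xi r) (q r)) ->
  forall (eps : R) (M : set 'rV[R]_(n + 1)),
    0 <= eps ->
    (* For c = 0 and eps > 0 the exterior bi-graphs are minimal catenoids, which
       do not translate, and for which the conclusion can fail. *)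
    (0 < eps -> 0 < c) ->
    soliton_family xi c eps M ->
    exists2 rho : R, 0 < rho &
      if eps == 0 then
        exists2 u : R -> R, is_graph_outside rho M u &
          soliton_asymptotics n xi h c u
      else
        exists u1 u2 : R -> R,
          [/\ is_bigraph_outside rho M u1 u2,
              soliton_asymptotics n xi h c u1
            & soliton_asymptotics n xi h c u2].
Proof.
move=> q _ o_hdq o_dh eps M eps0 eps_c.
have i0 : 'I_n by exists 0; apply: leq_trans hn.
rewrite /soliton_family; case: eqVneq => [epsE|eps_neq0].
  (* The bowl is a graph over all of [N], so any positive radius would do. *)
  move=> [M_soliton [u [u_smooth ME]]]; exists 1 => //; exists u.
    apply/seteqP; rewrite ME; split => p; rewrite /outside_cylinder /=; tauto.
  have u_smooth0 := smooth_on_sub (@subsetT _ [set x | 0 < pole_dist x]) u_smooth.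
  apply: (@asymptotics_of_ode _ n c 0 xi h u) => //; first by rewrite ltxx.
    by move=> r r0; have [] := radial_profile_derivable i0 (lexx 0) u_smooth0 r0.
  exact: bowl_ode ME.
move=> [M_soliton [u1 [u2 [u1_smooth u2_smooth _ u12 ME]]]].
have eps_gt0 : 0 < eps by rewrite lt_neqAle eq_sym eps_neq0.
(* The cylinder of radius [eps] contains the sphere where the sheets meet; beyond it they are
   strictly ordered. *)
exists eps => //; exists u1, u2; split.
- split=> //; apply/seteqP; rewrite ME; split => p; rewrite /outside_cylinder /=.
    by move=> [[_ hp] ep].
  by move=> [ep hp]; rewrite (ltW ep).
- apply: (@asymptotics_of_ode _ n c eps xi h u1) => //.
    by move=> r er; have [] := radial_profile_derivable i0 eps0 u1_smooth er.
  by apply: (winglike_ode i0 hxi eps0 u1_smooth u2_smooth u12 M_soliton ME); left.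
- apply: (@asymptotics_of_ode _ n c eps xi h u2) => //.
    by move=> r er; have [] := radial_profile_derivable i0 eps0 u2_smooth er.
  by apply: (winglike_ode i0 hxi eps0 u1_smooth u2_smooth u12 M_soliton ME); right.
Qed.
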